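(* Let $\bar d=(d_j)_{j\ge 0}$ be integers with $d_0=1$ and $d_j\ge 2$ for $j\ge 1$, let $\bar p=(p_j)_{j\ge 1}$ with $p_j\in(0,1]$, and let $\alpha>1$ be real. If $\sum_{j=1}^\infty(1-p_j)^\alpha=\infty$, then $\sigma_p(l^\alpha,\bar d,\bar p)=\emptyset$.
   Context: $\mathbb{Z}_+=\{0,1,2,\dots\}$. Put $q_j=d_0d_1\cdots d_j$ for $j\ge 0$. Every $n\in\mathbb{Z}_+$ has a unique expansion $n=\sum_{j\ge1}a_j(n)q_{j-1}$ with digits $a_j(n)\in\{0,\dots,d_j-1\}$, only finitely many nonzero. Put $\zeta_n=\min\{j\ge1: a_j(n)\ne d_j-1\}$. Let $S=[s(n,m)]_{n,m\ge0}$ be the stochastic matrix with entries: $s(n,n+1)=\prod_{j=1}^{\zeta_n}p_j$; $s(n,n)=1-p_1$; if $\zeta_n\ge2$, for $1\le r\le\zeta_n-1$, $s\big(n,\,n-\sum_{j=1}^r(d_j-1)q_{j-1}\big)=(1-p_{r+1})\prod_{j=1}^rp_j$; and $s(n,m)=0$ otherwise. Column sums of $S$ are at most $1$, and $(Sw)(n)=\sum_m s(n,m)w(m)$ defines a bounded linear operator on $l^\alpha=l^\alpha(\mathbb{Z}_+)$ (complex sequences). $\sigma_p(l^\alpha,\bar d,\bar p)$ denotes the point spectrum (set of eigenvalues) of $S$ acting on $l^\alpha$. *)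

(* Defs.v *)
From HB Require Import structures.
From mathcomp Require Import all_boot all_order all_algebra.
From mathcomp Require Import all_classical all_reals all_analysis.
From mathcomp Require Import complex.

Set Implicit Arguments.
Unset Strict Implicit.
Unset Printing Implicit Defensive.

Import Order.TTheory GRing.Theory Num.Theory.
Import numFieldNormedType.Exports.

Local Open Scope classical_set_scope.
Local Open Scope ring_scope.

Section Numeration.
Variable d : nat -> nat.
Local Open Scope nat_scope.

Definition q (j : nat) : nat := \prod_(0 <= i < j.+1) d i.

(* The digit a_j(n), for j >= 1; see [digit_lt], [digit_expansion] and
   [digit_unique]. *)
Definition digit (j n : nat) : nat := (n %/ q j.-1) %% d j.

(* min {j >= 1 | a_j(n) <> d_j - 1}: this minimum is at most n + 1 (see
   [zetaP]), so that a bounded search finds it. *)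
Definition zeta (n : nat) : nat :=
  (find (fun j => digit j n != (d j).-1) (iota 1 n.+1)).+1.

(* For r < zeta n, this is what n loses when its first r digits, all maximal,
   are reset to 0. *)
Definition drop_size (r : nat) : nat :=
  \sum_(1 <= j < r.+1) (d j).-1 * q j.-1.

Hypothesis d0 : d 0 = 1.
Hypothesis d_ge2 : forall j, 1 <= j -> 2 <= d j.

Lemma d_gt0 j : 0 < d j.
Proof. by case: j => [|j]; [rewrite d0 | apply: ltnW; apply: d_ge2]. Qed.

Lemma q0 : q 0 = 1.
Proof. by rewrite /q big_nat1. Qed.

Lemma qS j : q j.+1 = q j * d j.+1.
Proof. by rewrite /q big_nat_recr. Qed.

Lemma q_gt0 j : 0 < q j.
Proof. by elim: j => [|j IH]; rewrite ?q0 // qS muln_gt0 IH d_gt0. Qed.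

Lemma ltn_q j : j < q j.
Proof.
elim: j => [|j IH]; first by rewrite q0.
rewrite qS; apply: (@leq_trans (q j * 2)); last by rewrite leq_mul2l d_ge2 ?orbT.
by rewrite muln2 -addnn -addn1 leq_add // q_gt0.
Qed.

Lemma digit_lt j n : digit j n < d j.
Proof. by rewrite ltn_mod d_gt0. Qed.

Lemma digit_modq N n :
  n %% q N = \sum_(1 <= j < N.+1) digit j n * q j.-1.
Proof.
elim: N => [|N IH]; first by rewrite q0 modn1 big_geq.
rewrite big_nat_recr //= -IH /digit /= qS.
rewrite {1}(divn_eq n (q N)) {1}(divn_eq (n %/ q N) (d N.+1)).
rewrite mulnDl -mulnA [d _ * _]mulnC -addnA modnMDl addnC modn_small //.
apply: (@leq_trans (((n %/ q N) %% d N.+1).+1 * q N)).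
  by rewrite mulSn ltn_add2r ltn_mod q_gt0.
by rewrite mulnC leq_mul2l ltn_mod d_gt0 orbT.
Qed.

Lemma digit_expansion n N : n <= N ->
  n = \sum_(1 <= j < N.+1) digit j n * q j.-1.
Proof.
move=> nN; rewrite -digit_modq modn_small //.
exact: leq_ltn_trans nN (ltn_q N).
Qed.

Lemma digit_eq0 j n : n < j -> digit j n = 0.
Proof.
case: j => // j; rewrite ltnS => nj.
by rewrite /digit divn_small ?mod0n // (leq_ltn_trans nj (ltn_q j)).
Qed.

Lemma expansion_lt (a : nat -> nat) N :
  (forall j, 1 <= j -> a j < d j) ->
  \sum_(1 <= j < N.+1) a j * q j.-1 < q N.
Proof.
move=> ad; elim: N => [|N IH]; first by rewrite big_geq // q0.
rewrite big_nat_recr //= qS.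
apply: (@leq_trans ((a N.+1).+1 * q N)); first by rewrite mulSn ltn_add2r.
by rewrite mulnC leq_mul2l ad ?orbT.
Qed.

Lemma digit_unique (a : nat -> nat) n N :
  (forall j, 1 <= j -> a j < d j) ->
  n = \sum_(1 <= j < N.+1) a j * q j.-1 ->
  forall j, 1 <= j <= N -> a j = digit j n.
Proof.
move=> ad; elim: N n => [|N IH] n ->; first by move=> j /andP[]; case: j.
move=> j /andP[j1]; rewrite big_nat_recr //= leq_eqVlt.
set s := \sum_(_ <= _ < _) _.
have sN : s < q N by exact: expansion_lt.
case/orP => [/eqP ->|jN].
  rewrite /digit /= divnDr ?dvdn_mull // divn_small // mulnK ?q_gt0 //.
  by rewrite modn_small // ad.
rewrite (IH s erefl j) ?j1 //.
rewrite /digit.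
have [c qc] : exists c, q N = c * d j * q j.-1.
  elim: N jN {IH s sN} => [|N IH]; first by rewrite ltnS leqNgt j1.
  rewrite ltnS leq_eqVlt => /orP[/eqP ->|/IH [c qc]].
    by exists 1; rewrite mul1n qS mulnC.
  by exists (c * d N.+1); rewrite qS qc mulnAC [c * _ * _]mulnAC.
rewrite qc !mulnA divnDr ?dvdn_mull // mulnK ?q_gt0 //.
by rewrite addnC modnMDl.
Qed.

Lemma zetaP n :
  [/\ 1 <= zeta n <= n.+1, digit (zeta n) n != (d (zeta n)).-1 &
      forall j, 1 <= j -> digit j n != (d j).-1 -> zeta n <= j].
Proof.
pose P j := digit j n != (d j).-1.
have Pn : P n.+1.
  by rewrite /P digit_eq0 // eq_sym -lt0n -subn1 subn_gt0 d_ge2.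
have hasP : has P (iota 1 n.+1).
  by apply/hasP; exists n.+1 => //; rewrite mem_iota ltnS leqnn.
have := hasP; rewrite has_find size_iota => fn.
split.
- by rewrite /zeta ltnS /= -/P.
- by have := nth_find 0 hasP; rewrite nth_iota // add1n.
case=> // j _ Pj; rewrite /zeta ltnS leqNgt; apply/negP => jf.
have := before_find 0 jf; rewrite nth_iota ?add1n ?Pj //.
exact: ltn_trans jf fn.
Qed.

Lemma drop_size_le n r : r < zeta n -> drop_size r <= n.
Proof.
move=> rz; rewrite /drop_size.
have -> : \sum_(1 <= j < r.+1) (d j).-1 * q j.-1 = n %% q r.
  rewrite digit_modq; apply: eq_big_nat => j /andP[j1 jr].
  have [_ _ zmin] := zetaP n.
  have [->//|/(zmin _ j1)] := eqVneq (digit j n) (d j).-1.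
  by rewrite leqNgt (leq_ltn_trans _ rz).
exact: leq_mod.
Qed.

Lemma drop_size_mono r r' : r < r' -> drop_size r < drop_size r'.
Proof.
move: r r'; apply: (homo_ltn ltn_trans) => r.
rewrite /drop_size [ltnRHS]big_nat_recr //= -[ltnLHS]addn0 ltn_add2l.
by rewrite muln_gt0 q_gt0 andbT -subn1 subn_gt0 d_ge2.
Qed.

End Numeration.

Section Operator.
Variables (R : realType) (d : nat -> nat) (p : nat -> R).

(* At most one r contributes to the sum in the last branch; the values of the
   entries are spelled out in [s_succ], [s_diag], [s_drop] and [s_other]. *)
Definition s_mat (n m : nat) : R :=
  if m == n.+1 then \prod_(1 <= j < (zeta d n).+1) p j
  else if m == n then 1 - p 1%N
  else \sum_(1 <= r < zeta d n | m == (n - drop_size d r)%N)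
         (1 - p r.+1) * \prod_(1 <= j < r.+1) p j.

(* R[i]^o is R[i] with the topology of its norm.  Each row of [s_mat] has
   finitely many nonzero entries, so the series always converges: [S_opE]. *)
Definition S_op (w : nat -> R[i]) (n : nat) : R[i] :=
  limn (series (fun m => (s_mat n m)%:C%C * w m) : nat -> R[i]^o).

(* The norm `|z| is an element of R[i] with zero imaginary part. *)
Definition l_space (alpha : R) : set (nat -> R[i]) :=
  [set w | (\sum_(0 <= n <oo) ((complex.Re `|w n|) `^ alpha)%:E < +oo)%E].

(* An eigenvector w lies in l^alpha, and then so does S w = lambda w. *)
Definition point_spectrum (alpha : R) : set R[i] :=
  [set lambda | exists w : nat -> R[i],
     [/\ l_space alpha w, w <> (fun=> 0) &
         S_op w = (fun n => lambda * w n)]].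

Lemma s_succ n : s_mat n n.+1 = \prod_(1 <= j < (zeta d n).+1) p j.
Proof. by rewrite /s_mat eqxx. Qed.

Lemma s_diag n : s_mat n n = 1 - p 1%N.
Proof. by rewrite /s_mat eqxx ltn_eqF. Qed.

Lemma s_gt n m : (n.+1 < m)%N -> s_mat n m = 0.
Proof.
move=> nm; rewrite /s_mat gtn_eqF // gtn_eqF ?(ltnW nm) // big1 // => r /eqP mE.
by move: nm; rewrite mE ltnNge (leq_trans (leq_subr _ _)).
Qed.

Lemma S_opE w n : S_op w n = \sum_(0 <= m < n.+2) (s_mat n m)%:C%C * w m.
Proof.
apply: (@norm_lim_near_cst _ R[i]^o) => //; near=> N; rewrite /series /=.
have nN : (n.+2 <= N)%N by near: N; exists n.+2.
rewrite (@big_cat_nat _ _ _ n.+2) //= -[RHS]addr0; congr (_ + _).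
rewrite big_nat_cond big1 // => m; rewrite andbT => /andP[nm _].
by rewrite s_gt // mul0r.
Unshelve. all: by end_near. Qed.

Hypothesis d0 : d 0%N = 1%N.
Hypothesis d_ge2 : forall j, (1 <= j)%N -> (2 <= d j)%N.

Lemma drop_gt0 r : (1 <= r)%N -> (0 < drop_size d r)%N.
Proof. by move=> /(drop_size_mono d0 d_ge2); apply: leq_ltn_trans. Qed.

Lemma s_drop n r : (1 <= r < zeta d n)%N ->
  s_mat n (n - drop_size d r) = (1 - p r.+1) * \prod_(1 <= j < r.+1) p j.
Proof.
move=> /andP[r1 rz].
have rn := drop_size_le d0 d_ge2 rz.
have lt_n : (n - drop_size d r < n)%N.
  by rewrite -subn_gt0 subKn // drop_gt0.
rewrite /s_mat (ltn_eqF (leqW lt_n)) (ltn_eqF lt_n) big_mkcond.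
rewrite (bigD1_seq r) ?mem_index_iota ?r1 ?iota_uniq ?eqxx //=.
rewrite [X in _ + X]big1_seq ?addr0 // => r' /andP[r'r].
rewrite mem_index_iota => /andP[_ r'z]; case: eqP => // eq_drop.
have r'n := drop_size_le d0 d_ge2 r'z.
have {}eq_drop : drop_size d r = drop_size d r'.
  by rewrite -(subKn rn) eq_drop subKn.
move: r'r; rewrite neq_ltn => /orP[] /(drop_size_mono d0 d_ge2);
  by rewrite eq_drop ltnn.
Qed.

Lemma s_other n m : m <> n.+1 -> m <> n ->
  (forall r, (1 <= r < zeta d n)%N -> m <> (n - drop_size d r)%N) ->
  s_mat n m = 0.
Proof.
move=> /eqP/negPf mS /eqP/negPf mn mdrop; rewrite /s_mat mS mn.
rewrite big_mkcond big1_seq // => r; rewrite mem_index_iota => /= rz.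
by case: eqP => // /mdrop; case.
Qed.

End Operator.

(* Main.v *)
(* Row n of S w = lambda w determines w(n+1) from w(0), ..., w(n), so an
   eigenvector w has w(0) <> 0.  As the rows of S are invariant under
   translation by multiples of q_j up to column q_j - 1, comparing the rows
   q_j - 1 and q_(j+1) - 1 gives, with M = (d_(j+1) - 1) q_j,
     (1 - p_(j+2)) w(0)^2 = w(M) w(q_j) - p_(j+2) w(0) w(q_(j+1)).
   Since w is bounded, 1 - p_(j+2) is at most a constant times
   |w(q_j)| + |w(q_(j+1))|, whose alpha-th powers are summable in j. *)
Require Import Defs.
From mathcomp Require Import all_boot all_order all_algebra.
From mathcomp Require Import all_classical all_reals all_analysis.
From mathcomp Require Import complex.
From mathcomp Require Import ring.

Import Order.TTheory GRing.Theory Num.Theory.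
Import numFieldNormedType.Exports.

Local Open Scope classical_set_scope.
Local Open Scope ring_scope.

(** * Digits and [zeta] under translation by multiples of [q d j] *)

Section Digits.
Variable d : nat -> nat.
Hypothesis d0 : d 0%N = 1%N.
Hypothesis d_ge2 : forall j : nat, (1 <= j)%N -> (2 <= d j)%N.
Local Open Scope nat_scope.

(** The sum telescopes, as [(d i - 1) q_(i-1) = q_i - q_(i-1)]. *)
Lemma drop_sizeS j : (Defs.drop_size d j).+1 = q d j.
Proof.
elim: j => [|j IH]; first by rewrite /Defs.drop_size big_geq // q0.
rewrite /Defs.drop_size big_nat_recr //= -addSn -/(Defs.drop_size d j) IH qS.
have d_pos : 0 < d j.+1 by exact: d_gt0.
by rewrite -mulSn (prednK d_pos) mulnC.
Qed.

Lemma drop_sizeE j : Defs.drop_size d j = (q d j).-1.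
Proof. by rewrite -drop_sizeS. Qed.

Lemma dvdn_q i j : i <= j -> q d i %| q d j.
Proof.
move=> /subnK <-; elim: (j - i) => // k IH.
by rewrite addSn qS dvdn_mulr.
Qed.

Lemma digit_shift j m k i : q d j %| m -> 1 <= i <= j ->
  digit d i (m + k) = digit d i k.
Proof.
case: i => // i qm /andP[_ ij]; rewrite /digit /=.
have /dvdnP[c ->] : q d i.+1 %| m by exact: dvdn_trans (dvdn_q _ _ ij) qm.
rewrite qS mulnCA mulnC divnMDl ?q_gt0 //.
by rewrite [c * _]mulnC -modnDml modnMr.
Qed.

(** Otherwise the first [j] digits of [k] would all be maximal, forcing [k >= q_j - 1]. *)
Lemma zeta_le j k : k.+1 < q d j -> zeta d k <= j.
Proof.
move=> kj; rewrite leqNgt; apply/negP => jz.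
have := drop_size_le d0 d_ge2 jz.
by rewrite -ltnS drop_sizeS leqNgt kj.
Qed.

(** As [zeta d k <= j], only the first [j] digits matter, and adding [m] leaves them unchanged. *)
Lemma zeta_shift j m k : q d j %| m -> k.+1 < q d j ->
  zeta d (m + k) = zeta d k.
Proof.
move=> qm kj; have zj := zeta_le _ _ kj.
have [/andP[z1 _] zk zmin] := zetaP d0 d_ge2 k.
have [/andP[z1' _] zk' zmin'] := zetaP d0 d_ge2 (m + k).
have le1 : zeta d (m + k) <= zeta d k.
  by apply: zmin' => //; rewrite (digit_shift _ _ _ _ qm) ?z1.
apply/eqP; rewrite eqn_leq le1 zmin //.
by rewrite -(digit_shift _ _ _ _ qm) // z1' (leq_trans le1).
Qed.

(** The first [j] digits of [q_j - 1] are maximal; the next one is 0, which is not maximal because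
    [d j.+1 >= 2]. *)
Lemma zeta_predq j : zeta d (q d j).-1 = j.+1.
Proof.
have [/andP[z1 _] zk zmin] := zetaP d0 d_ge2 (q d j).-1.
apply/eqP; rewrite eqn_leq; apply/andP; split.
  apply: zmin => //; rewrite /digit /= divn_small ?prednK ?q_gt0 // mod0n.
  by have := d_ge2 j.+1 isT; case: (d j.+1) => [|[]].
rewrite ltnNge; apply/negP => zj; move/eqP: zk; apply; apply/esym.
apply: (@digit_unique d d0 d_ge2 (fun i => (d i).-1) _ j).
- by move=> i _; rewrite prednK ?leqnn ?d_gt0.
- by rewrite -drop_sizeE.
- by rewrite z1.
Qed.

(** The [q d j] strictly increase, so no term is counted twice on the left. *)
Lemma sum_q_le (R : numDomainType) (f : nat -> R) N : (forall n, (0 <= f n)%R) ->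
  (\sum_(0 <= j < N) f (q d j) <= \sum_(0 <= n < q d N) f n)%R.
Proof.
move=> f0; elim: N => [|N IH]; first by rewrite big_geq // sumr_ge0.
have lt_q : q d N < q d N.+1.
  by rewrite qS -[ltnLHS]muln1 ltn_pmul2l ?q_gt0 // d_ge2.
rewrite big_nat_recr //= (@big_cat_nat _ _ _ (q d N).+1 0 (q d N.+1)) //=.
rewrite big_nat_recr //= -[leLHS]addr0.
by apply: lerD; [apply: lerD|apply: sumr_ge0].
Qed.

End Digits.

(** * The recursion satisfied by an eigenvector *)

Section Eigenvector.
Variables (R : realType) (d : nat -> nat) (p : nat -> R).
Hypothesis d0 : d 0%N = 1%N.
Hypothesis d_ge2 : forall j : nat, (1 <= j)%N -> (2 <= d j)%N.
Hypothesis p01 : forall j : nat, (1 <= j)%N -> 0 < p j <= 1.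

Definition prodp (r : nat) : R := \prod_(1 <= j < r.+1) p j.

Lemma prodp_neq0 r : (prodp r)%:C%C != 0.
Proof.
rewrite fmorph_eq0 prodf_seq_neq0; apply/allP => j; rewrite mem_index_iota.
by move=> /andP[j1 _]; have /andP[/lt0r_neq0] := p01 _ j1.
Qed.

Lemma prodp0 : prodp 0 = 1.
Proof. by rewrite /prodp big_geq. Qed.

Lemma prodpS r : prodp r.+1 = p r.+1 * prodp r.
Proof. by rewrite /prodp big_nat_recr //= mulrC. Qed.

(** For [N = zeta d n] this is row [n] of the operator without column [n + 1]; [r = 0] is the
    diagonal entry. Leaving [N] free allows rows of different lengths to be compared. *)
Definition drops (w : nat -> R[i]) (N n : nat) : R[i] :=
  \sum_(0 <= r < N) ((1 - p r.+1) * prodp r)%:C%C * w (n - Defs.drop_size d r)%N.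

Lemma S_op_drops w n : S_op d p w n =
  (prodp (zeta d n))%:C%C * w n.+1 + drops w (zeta d n) n.
Proof.
have [/andP[z1 _] _ _] := zetaP d0 d_ge2 n.
rewrite S_opE 2?big_nat_recr //= s_succ s_diag addrC; congr (_ + _).
have drop0 : Defs.drop_size d 0 = 0%N by rewrite /Defs.drop_size big_geq.
rewrite /drops [in RHS]big_ltn // drop0 subn0 prodp0 mulr1 addrC; congr (_ + _).
have lt_n r : (1 <= r < zeta d n)%N -> (n - Defs.drop_size d r < n)%N.
  move=> /andP[r1 rz].
  rewrite -subn_gt0 subKn ?drop_gt0 //; exact: drop_size_le.
(* After exchanging the sums, each [r] selects a single column [m < n]. *)
transitivity (\sum_(0 <= m < n) \sum_(1 <= r < zeta d n)
    if m == (n - Defs.drop_size d r)%N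
    then ((1 - p r.+1) * prodp r)%:C%C * w m else 0).
  apply: eq_big_nat => m /andP[_ mn].
  rewrite /s_mat (ltn_eqF (leqW mn)) (ltn_eqF mn) rmorph_sum /= mulr_suml.
  by rewrite big_mkcond.
rewrite exchange_big /=; apply: eq_big_nat => r rz.
rewrite (bigD1_seq (n - Defs.drop_size d r)%N) ?mem_index_iota ?lt_n ?iota_uniq //=.
by rewrite eqxx big1 ?addr0 // => m /negPf ->.
Qed.

Variables (w : nat -> R[i]) (lambda : R[i]).
Hypothesis eigen : S_op d p w = (fun n => lambda * w n).

Lemma eigen_succ n :
  (prodp (zeta d n))%:C%C * w n.+1 = lambda * w n - drops w (zeta d n) n.
Proof.
have := S_op_drops w n; rewrite eigen => ->.
by rewrite addrK.
Qed.

(** The coefficient of [w n.+1] in row [n] is a product of positive [p j], so [w 0 = 0] would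
    propagate to every index. *)
Lemma eigen_neq0 : w <> (fun=> 0) -> w 0%N != 0.
Proof.
move=> w_neq0; apply/eqP => w0; apply: w_neq0; apply/funext => n.
elim/ltn_ind: n => -[//|n] IH; apply: (mulfI (prodp_neq0 (zeta d n))).
rewrite eigen_succ IH // !mulr0 /drops big1 ?subr0 // => r _.
by rewrite IH ?mulr0 // ltnS leq_subr.
Qed.

(** For [r < N] the drop is at most [n], so the truncated subtraction commutes with translation by
    [m]. *)
Lemma drops_shift N m n : (N <= zeta d n)%N ->
  (forall k, (k <= n)%N -> w 0%N * w (m + k)%N = w m * w k) ->
  w 0%N * drops w N (m + n) = w m * drops w N n.
Proof.
move=> Nz IH; rewrite /drops !mulr_sumr; apply: eq_big_nat => r /andP[_ rN].
rewrite -addnBA; last by apply: drop_size_le => //; exact: leq_trans Nz.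
by rewrite mulrCA IH ?leq_subr // mulrCA.
Qed.

(* For [k < q_j - 1] the rows [m + k] and [k] of the matrix agree up to
   translation by [m], and row [k] determines [w (k + 1)]. *)
Lemma eigen_shift j m k : (q d j %| m)%N -> (k < q d j)%N ->
  w 0%N * w (m + k)%N = w m * w k.
Proof.
move=> qm; elim/ltn_ind: k => -[|k] IH kj; first by rewrite addn0 mulrC.
apply: (mulfI (prodp_neq0 (zeta d k))).
have row := eigen_succ (m + k)%N.
rewrite (@zeta_shift d d0 d_ge2 j m k) // -addnS in row.
rewrite mulrCA [RHS]mulrCA eigen_succ row.
have IH' i : (i <= k)%N -> w 0%N * w (m + i)%N = w m * w i.
  by move=> ik; apply: IH => //; apply: leq_ltn_trans ik (ltnW kj).
by rewrite !mulrBr drops_shift // mulrCA IH' // mulrCA.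
Qed.

(* Compares the rows [q_(j+1) - 1] and [q_j - 1], of which the former has
   exactly one more entry, in column 0. *)
Lemma eigen_q j :
  (1 - p j.+2)%:C%C * w 0%N ^+ 2 =
  w ((d j.+1).-1 * q d j)%N * w (q d j)
  - (p j.+2)%:C%C * (w 0%N * w (q d j.+1)).
Proof.
set m := ((d j.+1).-1 * q d j)%N.
have q_pos i : (q d i).-1.+1 = q d i by rewrite prednK ?q_gt0.
have qE : (q d j.+1).-1 = (m + (q d j).-1)%N.
  apply: succn_inj; rewrite q_pos -addnS q_pos qS /m addnC -mulSn.
  by rewrite prednK ?d_gt0 // mulnC.
have shift k : (k <= (q d j).-1)%N -> w 0%N * w (m + k)%N = w m * w k.
  move=> kq; apply: (@eigen_shift j); first exact: dvdn_mull.
  by rewrite -q_pos ltnS.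
have row1 := eigen_succ (q d j.+1).-1.
have row0 := eigen_succ (q d j).-1.
move: row1 row0; rewrite !zeta_predq // !q_pos.
(* The last term of the longer row, [r = j + 1], drops [q_(j+1) - 1] and lands in column 0. *)
rewrite {1}/drops big_nat_recr //= -/(drops w j.+1 _).
rewrite drop_sizeE // subnn qE => row1 row0.
have dropsE : w 0%N * drops w j.+1 (m + (q d j).-1)
    = w m * drops w j.+1 (q d j).-1.
  by apply: drops_shift => //; rewrite zeta_predq.
have lastE := shift _ (leqnn _).
apply: (mulfI (prodp_neq0 j.+1)).
rewrite prodpS !rmorphM /= in row1.
(* With these multipliers the [lambda] terms and the common drops cancel on subtraction. *)
have /(congr1 (fun x => w 0%N * x)) := row1.
have /(congr1 (fun x => w m * x)) := row0.
rewrite !mulrBr !mulrDr dropsE => e0.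
rewrite [X in _ = X - _]mulrCA lastE => e1.
transitivity (w m * ((prodp j.+1)%:C%C * w (q d j))
  - w 0%N * ((p j.+2)%:C%C * (prodp j.+1)%:C%C * w (q d j.+1))); last by ring.
by rewrite e0 e1; ring.
Qed.

End Eigenvector.

(** * Power and series estimates *)

Lemma powRD_le (R : realType) (x y r : R) : 0 <= x -> 0 <= y -> 0 <= r ->
  (x + y) `^ r <= 2 `^ r * (x `^ r + y `^ r).
Proof.
(* The sum is at most twice its larger term. *)
move=> x0 y0 r0; wlog xy : x y x0 y0 / x <= y => [hwlog|].
  by case/orP: (le_total x y) => xy; [|rewrite addrC [x `^ r + _]addrC];
    exact: hwlog.
apply: (@le_trans _ _ (2 `^ r * y `^ r)).
  rewrite -powRM //; apply: ge0_ler_powR => //; rewrite ?nnegrE.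
  - exact: addr_ge0.
  - exact: mulr_ge0.
  - by rewrite mulr_natl mulr2n lerD2r.
by rewrite ler_wpM2l ?powR_ge0 // lerDr powR_ge0.
Qed.

Lemma nneseries_lty (R : realType) (u : nat -> R) (B : R) k :
  (forall n, 0 <= u n) -> (forall N, \sum_(k <= n < N) u n <= B) ->
  (\sum_(k <= n <oo) (u n)%:E < +oo)%E.
Proof.
move=> u0 uB; apply: (@le_lt_trans _ _ B%:E); last exact: ltry.
apply: lime_le; first by apply: is_cvg_nneseries => n _ _; rewrite lee_fin.
by apply: nearW => N; rewrite sumEFin lee_fin.
Qed.

Lemma nneseries_lty_bounded (R : realType) (u : nat -> R) :
  (forall n, 0 <= u n) -> (\sum_(0 <= n <oo) (u n)%:E < +oo)%E ->
  exists B, forall N, \sum_(0 <= n < N) u n <= B.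
Proof.
move=> u0 u_lty; exists (fine (\sum_(0 <= n <oo) (u n)%:E)%E) => N.
have uE0 n : (0%N <= n)%N -> true -> (0 <= (u n)%:E)%E.
  by rewrite lee_fin.
rewrite -lee_fin fineK; last first.
  by rewrite ge0_fin_numE // nneseries_ge0 // => n *; exact: uE0.
rewrite -sumEFin; apply: nneseries_lim_ge => n *; exact: uE0.
Qed.

(** * Comparison of the divergent series with the norm of an eigenvector *)

Theorem proposition4p17 (R : realType) (d : nat -> nat) (p : nat -> R)
    (alpha : R)
    (d0 : d 0%N = 1%N)
    (d_ge2 : forall j : nat, (1 <= j)%N -> (2 <= d j)%N)
    (p01 : forall j : nat, (1 <= j)%N -> 0 < p j <= 1)
    (alpha_gt1 : 1 < alpha)
    (p_div : (\sum_(1 <= j <oo) ((1 - p j) `^ alpha)%:E = +oo)%E) :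
  point_spectrum d p alpha = set0.
Proof.
apply/seteqP; split => // lambda [w [w_lp w_neq0 eigen]].
have alpha_ge0 : 0 <= alpha by apply: le_trans ler01 (ltW alpha_gt1).
pose N := @Normc.normc R.
have NM (x y : R[i]) : N (x * y) = N x * N y by exact: Normc.normcM.
have ND (x y : R[i]) : N (x - y) <= N x + N y.
  by rewrite -[N y]normcN; exact: le_normcD.
have N_ge0 (x : R[i]) : 0 <= N x by rewrite -lecR; exact: (normr_ge0 x).
have NR (x : R) : 0 <= x -> N x%:C%C = x.
  by move=> x0; rewrite /N /Normc.normc /= expr0n addr0 sqrtr_sqr ger0_norm.
have w0_gt0 : 0 < N (w 0%N).
  rewrite lt_neqAle N_ge0 andbT eq_sym; apply/eqP => /Normc.eq0_normc w00.
  have := eigen_neq0 R d p d0 d_ge2 p01 w lambda eigen w_neq0.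
  by rewrite w00 eqxx.
pose f n := N (w n) `^ alpha.
have f_ge0 n : 0 <= f n by exact: powR_ge0.
(* [complex.Re] of the norm computes to [N], so [w_lp] is a statement about [f]. *)
have [B fB] := @nneseries_lty_bounded R f f_ge0 w_lp.
(* A modulus above 1 is at most its [alpha]-th power, hence at most [B]. *)
have wB n : N (w n) <= 1 + B.
  have fnB : f n <= B.
    by apply: le_trans (fB n.+1); rewrite big_nat_recr //= lerDr sumr_ge0.
  have [w1|w1] := leP (N (w n)) 1.
    by apply: le_trans w1 _; rewrite lerDl; apply: le_trans fnB.
  apply: (@le_trans _ _ (f n)); last by apply: le_trans fnB _; rewrite lerDr.
  by rewrite /f -{1}[N _]powRr1 //; apply: ler_powR => //; apply: ltW.
(* [1 + B] bounds both coefficients in [eigen_q], [w M] and [p j.+2 * w 0]; the denominator comes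
   from the factor [w 0 ^+ 2]. *)
pose K := (1 + B) / N (w 0%N) ^+ 2.
have B_ge0 : 0 <= 1 + B by exact: le_trans (wB 0%N).
have K_ge0 : 0 <= K by rewrite divr_ge0 // exprn_ge0.
have p_le j : 1 - p j.+2 <= K * (N (w (q d j)) + N (w (q d j.+1))).
  have /andP[p_gt0 p_le1] := p01 j.+2 isT.
  have := eigen_q R d p d0 d_ge2 p01 w lambda eigen j.
  move=> /(congr1 N); rewrite expr2 !NM NR ?subr_ge0 // => e.
  rewrite /K mulrAC ler_pdivlMr ?exprn_gt0 // expr2 e.
  apply: le_trans (ND _ _) _; rewrite !NM NR ?(ltW p_gt0) // mulrDr.
  apply: lerD; first by rewrite ler_wpM2r.
  rewrite mulrA ler_wpM2r //; apply: le_trans (wB 0%N).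
  by rewrite ler_piMl.
suff : (\sum_(1 <= j <oo) ((1 - p j) `^ alpha)%:E < +oo)%E.
  by rewrite p_div ltxx.
pose D := K `^ alpha * 2 `^ alpha.
have D_ge0 : 0 <= D by rewrite mulr_ge0 ?powR_ge0.
(* The term [j = 1] stands apart because [p_le] starts at index 2; each [B] bounds one of the sums
   of [f (q d j)] and [f (q d j.+1)]. *)
apply: (@nneseries_lty R _ ((1 - p 1%N) `^ alpha + D * (B + B)) 1).
  by move=> n; exact: powR_ge0.
have fqB M : \sum_(0 <= j < M) f (q d j) <= B.
  by apply: le_trans (sum_q_le d d0 d_ge2 R f M f_ge0) (fB _).
(* Enlarging the range makes it nonempty and leaves exactly [M] terms after the first. *)
move=> M; apply: (@le_trans _ _ (\sum_(1 <= j < M.+2) (1 - p j) `^ alpha)).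
  case: M => [|M].
    by rewrite big_geq // sumr_ge0 // => *; exact: powR_ge0.
  rewrite (@big_cat_nat _ _ _ M.+1 1 M.+3) //=; last by rewrite !ltnS leqW.
  by rewrite lerDl sumr_ge0 // => *; exact: powR_ge0.
rewrite big_ltn // lerD2l big_add1 big_add1 /=.
apply: (@le_trans _ _
    (\sum_(0 <= j < M) D * (f (q d j) + f (q d j.+1)))).
  apply: ler_sum => j _.
  have /andP[_ p_le1] := p01 j.+2 isT.
  apply: (@le_trans _ _ ((K * (N (w (q d j)) + N (w (q d j.+1)))) `^ alpha)).
    by apply: ge0_ler_powR; rewrite ?nnegrE ?subr_ge0 // mulr_ge0 // addr_ge0.
  rewrite powRM ?addr_ge0 // /D -mulrA ler_wpM2l ?powR_ge0 //.
  exact: powRD_le.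
rewrite -mulr_sumr ler_wpM2l // big_split /=; apply: lerD => //.
apply: le_trans (fqB M.+1).
by rewrite big_nat_recl //= lerDr.
Qed.
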